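(* Let $\gamma\subset\mathbb S^3$ be a knot with Seifert surface $S$, let $0<\alpha<1$ and $\boldsymbol A=2\pi\alpha[S]$. Set $-\boldsymbol A:=2\pi\alpha[-S]$ and $\boldsymbol A_{\mathrm C}:=2\pi(1-\alpha)[-S]$, where $-S$ denotes $S$ with the opposite orientation. Then the charge conjugation $\mathrm C$ maps $\mathrm{dom}(\mathcal D_{\boldsymbol A}^{(-)})$ onto $\mathrm{dom}(\mathcal D_{-\boldsymbol A}^{(-)})$ and $$\mathrm C\,\mathcal D_{\boldsymbol A}^{(-)}=\mathcal D_{-\boldsymbol A}^{(-)}\,\mathrm C .$$ Furthermore, $$\mathcal D_{\boldsymbol A}^{(+)}=\mathcal D_{\boldsymbol A_{\mathrm C}}^{(-)}.$$
   Context: Geometry and spinors. $\mathbb S^3\subset\mathbb C^2$ is the unit sphere with induced metric $g_3$, oriented so that the stereographic projection $(z_0,z_1)\mapsto \frac{(\mathrm{Re}\,z_0,\mathrm{Im}\,z_0,\mathrm{Re}\,z_1)}{1-\mathrm{Im}\,z_1}$ to $\mathbb R^3$ preserves orientation. Spinors are $\mathbb C^2$-valued functions (sections of the trivial bundle), with inner product $\langle\cdot,\cdot\rangle$ antilinear in the first slot, and Clifford map $\boldsymbol\sigma$ from $T^*\mathbb S^3$ to trace-free Hermitian endomorphisms, normalized so that in the trivialization adapted to a global positively oriented orthonormal frame $(\boldsymbol e_j)$ with dual frame $(\boldsymbol e^j)$, $\boldsymbol\sigma(\boldsymbol e^j)$ is the $j$-th Pauli matrix $\sigma_j$. $\nabla$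 on spinors is the canonical spin connection induced by the Levi-Civita connection; $-i\boldsymbol\sigma(\nabla)=-i\sum_j\boldsymbol\sigma(\boldsymbol e^j)\nabla_{\boldsymbol e_j}$ is the free Dirac operator. In this trivialization the charge conjugation is the antilinear map $\mathrm C\psi=i\sigma_2\overline\psi$ (pointwise). Operators. A knot is a smooth oriented submanifold of $\mathbb S^3$ diffeomorphic to $\mathbb S^1$. A Seifert surface for $\gamma$ is a smooth, compact, connected, oriented surface $S\subset\mathbb S^3$ with $\partial S=\gamma$ as oriented manifolds (so $-S$ is a Seifert surface for $\gamma$ with reversed orientation); $S_\pm$ are its top/bottom sides relative to its oriented unit normal $\boldsymbol N$; $\Omega_S=\mathbb S^3\setminus S$; $2\pi\alpha[S]$ records the pair $(S,\alpha)$. $\mathcal D_{\boldsymbol A}^{(\min)}$ acts as $-i\boldsymbol\sigma(\nabla)$ on $\Omega_S$ (result viewed in $L^2(\mathbb S^3)^2$); its domain is the graph-norm closure of the set of $\psi\in C^\infty(\Omega_S)^2$ with $\mathrm{supp}\,\psi\subset\mathbb S^3\setminus\gamma$, such that the limits $\psi|_{S_\pm}$ exist, are continuous on $S$, and satisfy $\psi|_{S_+}=e^{-2i\pi\alpha}\psi|_{S_-}$. Near $\gamma$, let $(\boldsymbol T,\boldsymbol S,\boldsymbol N)$ be the positively oriented orthonormal Seifert frame (unit tangent of $\gamma$, unit vector pointing into $S$, normal of $S$), extended to a small tubular neighbourhood by parallel transport along the geodesics issuing normally from $\gamma$, and let $\xi_\pm$ be smooth normalized spinors there (also parallel along these geodesics)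 with $\boldsymbol\sigma(\boldsymbol T^\flat)\xi_\pm=\pm\xi_\pm$ and $\omega(\boldsymbol S)+i\omega(\boldsymbol N)=\langle\xi_-,\boldsymbol\sigma(\omega)\xi_+\rangle$ for all one-forms $\omega$. Let $\chi_{\delta,\gamma}=\chi(\mathrm{dist}_{g_3}(\cdot,\gamma)/\delta)$ with $\chi\ge0$ smooth, supported in $[-1,1]$, equal to $1$ on $[-\frac12,\frac12]$, and $\delta>0$ small. The self-adjoint operators $\mathcal D_{\boldsymbol A}^{(\pm)}$ are the restrictions of $(\mathcal D_{\boldsymbol A}^{(\min)})^*$ to $\{\psi\in\mathrm{dom}((\mathcal D_{\boldsymbol A}^{(\min)})^* ):\langle\xi_\mp,\chi_{\delta,\gamma}\psi\rangle\xi_\mp\in\mathrm{dom}(\mathcal D_{\boldsymbol A}^{(\min)})\}$; they act as $-i\boldsymbol\sigma(\nabla)$ on $\Omega_S$. *)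

(* Defs.v *)
From HB Require Import structures.
From mathcomp Require Import all_boot all_order all_algebra.
From mathcomp Require Import all_classical all_reals all_analysis.
From mathcomp Require Import complex.

Set Implicit Arguments.
Unset Strict Implicit.
Unset Printing Implicit Defensive.

Import Order.TTheory GRing.Theory Num.Theory.
Import numFieldNormedType.Exports.

Local Open Scope classical_set_scope.
Local Open Scope ring_scope.
Local Open Scope complex_scope.

(** * Euclidean R^4 = C^2 and the sphere *)

(* [x] stands for (z_0, z_1) with z_0 = x_0 + i x_1 and z_1 = x_2 + i x_3.
   The library norm on this type is the sup norm, hence [dotv] and [enorm]. *)
Notation vec R := 'rV[R]_4.

Definition dotv {R : realType} (u v : vec R) : R := \sum_i u 0 i * v 0 i.

Definition enorm {R : realType} (u : vec R) : R := Num.sqrt (dotv u u).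

Definition sphere {R : realType} : set (vec R) := [set x | dotv x x = 1].

Definition radial {R : realType} (y : vec R) : vec R := (enorm y)^-1 *: y.

(* Tangent vectors (a, b, c) at p form a positively oriented basis of T_p S^3
   iff [0 < det4 p a b c].  This is the orientation preserved by the
   stereographic projection (x_0, x_1, x_2) / (1 - x_3): at p = (0, 0, 0, -1)
   its differential is half the projection on the first three coordinates, and
   [det4 p] of the first three coordinate vectors is 1. *)
Definition det4 {R : realType} (p a b c : vec R) : R :=
  \det (\matrix_(i < 4, j < 4) (nth 0 [:: p; a; b; c] i) 0 j).

(* Unit-speed geodesic of S^3 from p with initial velocity v, for
   |p| = |v| = 1 and v orthogonal to p. *)
Definition geo {R : realType} (p v : vec R) (t : R) : vec R :=
  cos t *: p + sin t *: v.

Definition geo_velocity {R : realType} (p v : vec R) (t : R) : vec R :=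
  cos t *: v - sin t *: p.

(* Distance for the induced metric: the geodesic distance of two points of the
   sphere is the angle between them. *)
Definition gdist {R : realType} (K : set (vec R)) (x : vec R) : R :=
  inf [set acos (dotv x p) | p in K].

(** * Smoothness *)

Fixpoint times_differentiable {R : realType} {V W : normedModType R} (k : nat)
    (U : set V) (f : V -> W) : Prop :=
  if k is k'.+1 then
    (forall x, U x -> differentiable f x) /\
    forall v, times_differentiable k' U (fun x => 'D_v f x)
  else True.

Definition smooth {R : realType} {V W : normedModType R}
    (U : set V) (f : V -> W) : Prop :=
  forall k, times_differentiable k U f.

(* Objects living on (a part of) S^3 are represented by total functions on R^4
   of which only the values on the sphere matter; they are differentiated
   through their extension that is constant along rays. *)
Definition cone {R : realType} (Omega : set (vec R)) : set (vec R) :=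
  [set y | y != 0 /\ Omega (radial y)].

Definition vsmooth {R : realType} (Omega : set (vec R)) (X : vec R -> vec R) :
    Prop :=
  smooth (cone Omega) (X \o radial).

(** * Spinors *)

Notation spinor R := 'cV[R[i]]_2.
Notation sfield R := (vec R -> spinor R).

(* Real coordinates of a spinor; limits, derivatives and measurability of
   spinors are understood coordinatewise. *)
Definition re_coord {R : realType} (k : 'I_2) (s : spinor R) : R :=
  complex.Re (s k 0).

Definition im_coord {R : realType} (k : 'I_2) (s : spinor R) : R :=
  complex.Im (s k 0).

Definition hdot {R : realType} (s t : spinor R) : R[i] :=
  \sum_k conjc (s k 0) * t k 0.

Definition ssmooth {R : realType} (Omega : set (vec R)) (psi : sfield R) :
    Prop :=
  forall k,
    smooth (cone Omega) (fun y => re_coord k (psi (radial y)) : R^o) /\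
    smooth (cone Omega) (fun y => im_coord k (psi (radial y)) : R^o).

Definition mx22 {R : realType} (a b c d : R[i]) : 'M[R[i]]_2 :=
  \matrix_(i, j) nth 0 (nth [::] [:: [:: a; b]; [:: c; d]] i) j.

(* [pauli 0], [pauli 1], [pauli 2] are sigma_1, sigma_2, sigma_3. *)
Definition pauli {R : realType} (j : 'I_3) : 'M[R[i]]_2 :=
  nth 0 [:: mx22 0 1 1 0; mx22 0 (- 'i%C) 'i%C 0; mx22 1 0 0 (- 1)] j.

Definition charge_conj {R : realType} (psi : sfield R) : sfield R :=
  fun x => 'i%C *: (pauli 1 *m map_mx conjc (psi x)).

(* A global positively oriented orthonormal frame of T S^3. *)
Record is_frame {R : realType} (e : 'I_3 -> vec R -> vec R) : Prop := {
  frame_smooth : forall j, vsmooth sphere (e j);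
  frame_tangent : forall j x, sphere x -> dotv (e j x) x = 0;
  frame_orthonormal : forall j k x, sphere x ->
    dotv (e j x) (e k x) = (j == k)%:R;
  frame_positive : forall x, sphere x -> 0 < det4 x (e 0 x) (e 1 x) (e 2 x) }.

(* Clifford map; covectors of S^3 at x are restrictions of linear forms on
   R^4. *)
Definition clifford {R : realType} (e : 'I_3 -> vec R -> vec R) (x : vec R)
    (omega : vec R -> R) : 'M[R[i]]_2 :=
  \sum_j (omega (e j x))%:C *: pauli j.

(* Levi-Civita connection of S^3: tangential part of the derivative in R^4. *)
Definition lc_nabla {R : realType} (v : vec R) (X : vec R -> vec R)
    (x : vec R) : vec R :=
  'D_v (X \o radial) x + dotv v (X x) *: x.

(* Spin connection in the trivialization adapted to e.  With the convention
   sigma_j sigma_k + sigma_k sigma_j = 2 delta_jk, the coefficient and sign of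
   the zeroth order term are those for which
   [nabla_v, sigma(X)] = sigma(nabla_v X). *)
Definition spin_nabla {R : realType} (e : 'I_3 -> vec R -> vec R) (v : vec R)
    (psi : sfield R) (x : vec R) : spinor R :=
  (\col_k ('D_v (fun y => re_coord k (psi (radial y)) : R^o) x
           +i* 'D_v (fun y => im_coord k (psi (radial y)) : R^o) x))
  + \sum_k \sum_l (4^-1 * dotv (e k x) (lc_nabla v (e l) x))%:C
                  *: (pauli k *m pauli l *m psi x).

Definition dirac_op {R : realType} (e : 'I_3 -> vec R -> vec R)
    (psi : sfield R) : sfield R :=
  fun x => (- 'i%C) *: \sum_j pauli j *m spin_nabla e (e j x) psi x.

(** * Square-integrable spinors *)

Definition sqnorm3 {R : realType} (y : R * R * R) : R :=
  y.1.1 ^+ 2 + y.1.2 ^+ 2 + y.2 ^+ 2.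

Definition stereo_inv {R : realType} (y : R * R * R) : vec R :=
  (1 + sqnorm3 y)^-1 *:
  \row_(i < 4) nth 0 [:: 2 * y.1.1; 2 * y.1.2; 2 * y.2; sqnorm3 y - 1] i.

Definition lebesgue3 {R : realType} :=
  ((@lebesgue_measure R \x @lebesgue_measure R) \x @lebesgue_measure R)%E.

(* Riemannian volume density of S^3 in the stereographic chart, where
   g_3 = (2 / (1 + |y|^2))^2 |dy|^2; the chart misses a single point. *)
Definition vol_density {R : realType} (y : R * R * R) : R :=
  (2 / (1 + sqnorm3 y)) ^+ 3.

Definition sphere_int {R : realType} (f : vec R -> R) : R :=
  \int[lebesgue3]_y (f (stereo_inv y) * vol_density y).

Definition l2sq {R : realType} (psi : sfield R) : \bar R :=
  (\int[lebesgue3]_y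
    (complex.Re (hdot (psi (stereo_inv y)) (psi (stereo_inv y)))
       * vol_density y)%:E)%E.

Definition l2 {R : realType} (psi : sfield R) : Prop :=
  (forall k,
     measurable_fun [set: measurableTypeR R * measurableTypeR R
                          * measurableTypeR R]
       (fun y => re_coord k (psi (stereo_inv y))) /\
     measurable_fun [set: measurableTypeR R * measurableTypeR R
                          * measurableTypeR R]
       (fun y => im_coord k (psi (stereo_inv y)))) /\
  (l2sq psi < +oo)%E.

Definition l2dot {R : realType} (psi phi : sfield R) : R[i] :=
  sphere_int (fun x => complex.Re (hdot (psi x) (phi x)))
  +i* sphere_int (fun x => complex.Im (hdot (psi x) (phi x))).

(** * Operators on L^2, as graphs *)

(* Elements of L^2(S^3)^2 are represented by functions; the graphs produced by
   [op_closure] and [op_adjoint] are saturated for equality almost everywhere,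
   so equality of such graphs is equality of the operators. *)
Notation operator R := (set (sfield R * sfield R)).

Definition op_dom {R : realType} (D : operator R) : set (sfield R) :=
  [set psi | exists phi, D (psi, phi)].

Definition op_closure {R : realType} (D : operator R) : operator R :=
  [set w | l2 w.1 /\ l2 w.2 /\
    forall eps : R, 0 < eps -> exists z, D z /\
      (l2sq (fun x => z.1 x - w.1 x)%R + l2sq (fun x => z.2 x - w.2 x)%R
         < eps%:E)%E].

Definition op_adjoint {R : realType} (D : operator R) : operator R :=
  [set w | l2 w.1 /\ l2 w.2 /\
    forall z, D z -> l2dot w.2 z.1 = l2dot w.1 z.2].

Definition op_restrict {R : realType} (D : operator R)
    (P : set (sfield R)) : operator R :=
  [set w | D w /\ P w.1].

(* T D and D T for an operator D and an everywhere defined map T. *)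
Definition op_after {R : realType} (T : sfield R -> sfield R)
    (D : operator R) : operator R :=
  [set w | exists2 phi, D (w.1, phi) & w.2 = T phi].

Definition op_before {R : realType} (D : operator R)
    (T : sfield R -> sfield R) : operator R :=
  [set w | D (T w.1, w.2)].

(** * Knots *)

(* The orientation of a curve is its unit tangent field; only the values of
   [ktan] on [kset] matter. *)
Record oriented_curve (R : realType) := OrientedCurve {
  kset : set (vec R);
  ktan : vec R -> vec R }.

Definition opp_curve {R : realType} (g : oriented_curve R) :
    oriented_curve R :=
  OrientedCurve (kset g) (fun x => - ktan g x).

(* Image of an embedding of the circle R / Z. *)
Definition is_knot {R : realType} (g : oriented_curve R) : Prop :=
  exists c : R^o -> vec R,
    smooth [set: R^o] c /\
    (forall t, c (t + 1) = c t) /\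
    (forall s t, c s = c t -> exists m : int, s - t = m%:~R) /\
    (forall t, sphere (c t)) /\
    (forall t, derive1 c t != 0) /\
    kset g = range c /\
    (forall t, ktan g (c t) = (enorm (derive1 c t))^-1 *: derive1 c t).

(** * Seifert surfaces *)

(* The orientation of a surface in S^3 is its unit normal field: a basis
   (a, b) of a tangent plane is positive iff (a, b, N) is positive in S^3. *)
Record oriented_surface (R : realType) := OrientedSurface {
  surf : set (vec R);
  normal : vec R -> vec R }.

Definition opp_surface {R : realType} (S : oriented_surface R) :
    oriented_surface R :=
  OrientedSurface (surf S) (fun x => - normal S x).

(* Phi : U -> V is a diffeomorphism of open subsets of R^4, with inverse Psi,
   straightening S to the half-plane y_1 >= 0, y_2 = y_3 = 0. *)
Record slice_chart {R : realType} (S U V : set (vec R))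
    (Phi Psi : vec R -> vec R) : Prop := {
  chart_open : open U /\ open V;
  chart_smooth : smooth U Phi /\ smooth V Psi;
  chart_to : forall x, U x -> V (Phi x) /\ Psi (Phi x) = x;
  chart_from : forall y, V y -> U (Psi y) /\ Phi (Psi y) = y;
  chart_slice : forall x, U x ->
    (S x <-> [/\ 0 <= Phi x 0 1, Phi x 0 2 = 0 & Phi x 0 3 = 0]) }.

Definition boundary {R : realType} (S : set (vec R)) : set (vec R) :=
  [set p | S p /\ exists U V Phi Psi,
    [/\ slice_chart S U V Phi Psi, U p & Phi p 0 1 = 0]].

Definition tangent_to {R : realType} (S : set (vec R)) (p w : vec R) : Prop :=
  exists U V Phi Psi (y : vec R),
    [/\ slice_chart S U V Phi Psi, U p, y 0 2 = 0, y 0 3 = 0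
      & w = 'D_y Psi (Phi p)].

(* For p in the boundary: w is tangent to S and points into S. *)
Definition points_into {R : realType} (S : set (vec R)) (p w : vec R) : Prop :=
  exists U V Phi Psi (y : vec R),
    [/\ slice_chart S U V Phi Psi, U p,
        0 < y 0 1, y 0 2 = 0 /\ y 0 3 = 0 & w = 'D_y Psi (Phi p)].

Record is_seifert {R : realType} (S : oriented_surface R)
    (g : oriented_curve R) : Prop := {
  seifert_sphere : surf S `<=` sphere;
  seifert_compact : compact (surf S);
  seifert_connected : connected (surf S);
  seifert_submanifold : forall p, surf S p ->
    exists U V Phi Psi, slice_chart (surf S) U V Phi Psi /\ U p;
  seifert_normal : forall p, surf S p ->
    [/\ dotv (normal S p) (normal S p) = 1, dotv (normal S p) p = 0
      & forall w, tangent_to (surf S) p w -> dotv (normal S p) w = 0];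
  seifert_oriented : {within surf S, continuous (normal S)};
  seifert_boundary : boundary (surf S) = kset g;
  (* (outward vector, tangent of the boundary) is positive in T_p S *)
  seifert_boundary_oriented : forall p w, kset g p ->
    points_into (surf S) p w -> 0 < det4 p (- w) (ktan g p) (normal S p) }.

(** * Tubular neighbourhoods and Seifert frames *)

Definition unit_normal_to {R : realType} (g : oriented_curve R)
    (p v : vec R) : Prop :=
  [/\ dotv v v = 1, dotv v p = 0 & dotv v (ktan g p) = 0].

(* The normal exponential map of g is injective on normal vectors shorter than
   eps. *)
Definition tubular_radius {R : realType} (g : oriented_curve R) (eps : R) :
    Prop :=
  0 < eps /\
  forall p v t p' v' t', kset g p -> kset g p' ->
    unit_normal_to g p v -> unit_normal_to g p' v' ->
    0 <= t < eps -> 0 <= t' < eps -> geo p v t = geo p' v' t' ->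
    p = p' /\ t *: v = t' *: v'.

Definition tube {R : realType} (g : oriented_curve R) (eps : R) :
    set (vec R) :=
  [set x | sphere x /\ gdist (kset g) x < eps].

Record seifert_frame (R : realType) := SeifertFrame {
  fT : vec R -> vec R;
  fS : vec R -> vec R;
  fN : vec R -> vec R;
  xi_plus : sfield R;
  xi_minus : sfield R }.

Definition vparallel {R : realType} (g : oriented_curve R) (eps : R)
    (X : vec R -> vec R) : Prop :=
  forall p v t, kset g p -> unit_normal_to g p v -> `|t| < eps ->
    lc_nabla (geo_velocity p v t) X (geo p v t) = 0.

Definition sparallel {R : realType} (e : 'I_3 -> vec R -> vec R)
    (g : oriented_curve R) (eps : R) (xi : sfield R) : Prop :=
  forall p v t, kset g p -> unit_normal_to g p v -> `|t| < eps ->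
    spin_nabla e (geo_velocity p v t) xi (geo p v t) = 0.

Record is_seifert_frame {R : realType} (e : 'I_3 -> vec R -> vec R)
    (g : oriented_curve R) (S : oriented_surface R) (eps : R)
    (F : seifert_frame R) : Prop := {
  frame_tangent_normal : forall p, kset g p ->
    fT F p = ktan g p /\ fN F p = normal S p;
  frame_conormal : forall p, kset g p ->
    [/\ dotv (fS F p) (fS F p) = 1, dotv (fS F p) (fT F p) = 0,
        dotv (fS F p) (fN F p) = 0 & points_into (surf S) p (fS F p)];
  frame_oriented : forall p, kset g p ->
    0 < det4 p (fT F p) (fS F p) (fN F p);
  frame_vsmooth : [/\ vsmooth (tube g eps) (fT F), vsmooth (tube g eps) (fS F)
                    & vsmooth (tube g eps) (fN F)];
  frame_vparallel : [/\ vparallel g eps (fT F), vparallel g eps (fS F)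
                      & vparallel g eps (fN F)];
  xi_smooth : ssmooth (tube g eps) (xi_plus F) /\
              ssmooth (tube g eps) (xi_minus F);
  xi_parallel : sparallel e g eps (xi_plus F) /\
                sparallel e g eps (xi_minus F);
  xi_normalized : forall x, tube g eps x ->
    hdot (xi_plus F x) (xi_plus F x) = 1 /\
    hdot (xi_minus F x) (xi_minus F x) = 1;
  xi_eigen : forall x, tube g eps x ->
    clifford e x (dotv (fT F x)) *m xi_plus F x = xi_plus F x /\
    clifford e x (dotv (fT F x)) *m xi_minus F x = - xi_minus F x;
  xi_phase : forall x (omega : {linear vec R -> R^o}), tube g eps x ->
    hdot (xi_minus F x) (clifford e x omega *m xi_plus F x)
      = omega (fS F x) +i* omega (fN F x) }.

(** * Dirac operators *)

(* The singular magnetic potential 2 pi alpha [S]. *)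
Record potential (R : realType) := Potential {
  pot_surf : oriented_surface R;
  pot_flux : R }.

(* g is the limit of psi on the side of S to which sgn * N points (sgn = 1 or
   -1): psi(exp_q (sgn t N_q)) tends to g(p) as q -> p in S and t -> 0+. *)
Definition has_trace {R : realType} (S : oriented_surface R) (sgn : R)
    (psi g : sfield R) : Prop :=
  forall p k, surf S p ->
    let side := within [set qt : vec R * R^o | surf S qt.1 /\ 0 < qt.2]
                       (nbhs (p, 0 : R^o)) in
    let psi_near (qt : vec R * R^o) :=
      psi (geo qt.1 (normal S qt.1) (sgn * qt.2)) in
    (fun qt => re_coord k (psi_near qt) : R^o) @ side --> re_coord k (g p) /\
    (fun qt => im_coord k (psi_near qt) : R^o) @ side --> im_coord k (g p).

Definition scontinuous {R : realType} (S : set (vec R)) (g : sfield R) :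
    Prop :=
  forall k, {within S, continuous (fun x => re_coord k (g x) : R^o)} /\
            {within S, continuous (fun x => im_coord k (g x) : R^o)}.

(* The support is the closure in S^3, not in S^3 \ S. *)
Definition core_dom {R : realType} (A : potential R) : set (sfield R) :=
  let S := pot_surf A in
  let Omega := sphere `\` surf S in
  [set psi |
    [/\ ssmooth Omega psi,
        closure [set x | Omega x /\ psi x != 0] `&` boundary (surf S) = set0
      & exists gp gm : sfield R,
        [/\ has_trace S 1 psi gp, has_trace S (- 1) psi gm,
            scontinuous (surf S) gp, scontinuous (surf S) gm
          & let theta := - (2 * pi * pot_flux A) in
            forall p, surf S p ->
              gp p = (cos theta +i* sin theta) *: gm p]]].

(* Values on the null set S are irrelevant, whence the condition on Omega. *)
Definition D_core {R : realType} (e : 'I_3 -> vec R -> vec R)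
    (A : potential R) : operator R :=
  [set w | [/\ core_dom A w.1, l2 w.1, l2 w.2
    & forall x, (sphere `\` surf (pot_surf A)) x -> w.2 x = dirac_op e w.1 x]].

Definition D_min {R : realType} (e : 'I_3 -> vec R -> vec R)
    (A : potential R) : operator R :=
  op_closure (D_core e A).

Record is_cutoff {R : realType} (chi : R^o -> R^o) : Prop := {
  cutoff_smooth : smooth [set: R^o] chi;
  cutoff_ge0 : forall t, 0 <= chi t;
  cutoff_support : forall t, 1 < `|t| -> chi t = 0;
  cutoff_one : forall t, `|t| <= 2^-1 -> chi t = 1 }.

Definition cutoff_proj {R : realType} (chi : R -> R) (delta : R)
    (K : set (vec R)) (xi psi : sfield R) : sfield R :=
  fun x => hdot (xi x) ((chi (gdist K x / delta))%:C *: psi x) *: xi x.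

Definition D_ext {R : realType} (e : 'I_3 -> vec R -> vec R)
    (chi : R -> R) (delta : R) (xi : sfield R) (A : potential R) :
    operator R :=
  op_restrict (op_adjoint (D_min e A))
    [set psi | op_dom (D_min e A)
       (cutoff_proj chi delta (boundary (surf (pot_surf A))) xi psi)].

(* The sign of the operator is opposite to that of the spinor whose component
   is required to be in the minimal domain. *)
Definition D_plus {R : realType} (e : 'I_3 -> vec R -> vec R)
    (chi : R -> R) (delta : R) (F : seifert_frame R) (A : potential R) :
    operator R :=
  D_ext e chi delta (xi_minus F) A.

Definition D_minus {R : realType} (e : 'I_3 -> vec R -> vec R)
    (chi : R -> R) (delta : R) (F : seifert_frame R) (A : potential R) :
    operator R :=
  D_ext e chi delta (xi_plus F) A.

(* Main.v *)
(** Charge conjugation C is antiunitary, anticommutes with the Pauli matrices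
    and hence commutes with the Dirac operator; it conjugates the phase of the
    jump across S, which reversing the normal compensates.  Replacing alpha by
    1 - alpha and reversing the normal leaves the jump condition unchanged.
    Both facts pass to closures and adjoints.  It remains to compare the
    boundary conditions.  By uniqueness of parallel transport along the
    geodesics normal to the knot, the tangent field of the frame of -S is
    opposite to that of the frame of S on the whole tube.  So the spinors
    xi_+ of -S, C xi_+ of S and xi_- of S span the same eigenline of
    sigma(T), and the condition only involves the projection onto it. *)

Require Import Defs.
From mathcomp Require Import all_boot all_order all_algebra.
From mathcomp Require Import all_classical all_reals all_analysis.
From mathcomp Require Import measurable_realfun complex ring lra.

Import Order.TTheory GRing.Theory Num.Theory.
Import numFieldNormedType.Exports.

Local Open Scope classical_set_scope.
Local Open Scope ring_scope.
Local Open Scope complex_scope.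

(** * Charge conjugation *)

Definition spinor_conj {R : realType} (s : spinor R) : spinor R :=
  'i%C *: (pauli 1 *m map_mx conjc s).

Lemma ord2P (k : 'I_2) : k = 0 \/ k = 1.
Proof. by case: k => [[|[|//]] h]; [left|right]; apply: val_inj. Qed.

Lemma ord3P (k : 'I_3) : [\/ k = 0, k = 1 | k = 2].
Proof.
by case: k => [[|[|[|//]]] h];
  [apply: Or31|apply: Or32|apply: Or33]; apply: val_inj.
Qed.

Lemma spinor_conj0 {R : realType} (s : spinor R) :
  spinor_conj s 0 0 = conjc (s 1 0).
Proof.
rewrite /spinor_conj /pauli /= !mxE big_ord_recl big_ord1 !mxE /=.
have -> : lift ord0 ord0 = 1 :> 'I_2 by apply: val_inj.
by case: (s 1 0) => a b; simpc.
Qed.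

Lemma spinor_conj1 {R : realType} (s : spinor R) :
  spinor_conj s 1 0 = - conjc (s 0 0).
Proof.
rewrite /spinor_conj /pauli /= !mxE big_ord_recl big_ord1 !mxE /=.
by case: (s 0 0) => a b; simpc.
Qed.

Lemma spinor_conjD {R : realType} (s t : spinor R) :
  spinor_conj (s + t) = spinor_conj s + spinor_conj t.
Proof. by rewrite /spinor_conj map_mxD mulmxDr scalerDr. Qed.

Lemma spinor_conjZ {R : realType} (a : R[i]) (s : spinor R) :
  spinor_conj (a *: s) = conjc a *: spinor_conj s.
Proof. by rewrite /spinor_conj map_mxZ -scalemxAr scalerA mulrC -scalerA. Qed.

Lemma spinor_conj_zero {R : realType} : spinor_conj (0 : spinor R) = 0.
Proof. by rewrite /spinor_conj map_mx0 mulmx0 scaler0. Qed.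

Lemma spinor_conjN {R : realType} (s : spinor R) :
  spinor_conj (- s) = - spinor_conj s.
Proof. by rewrite -scaleN1r spinor_conjZ rmorphN1 scaleN1r. Qed.

Lemma spinor_conj_sum {R : realType} (n : nat) (f : 'I_n -> spinor R) :
  spinor_conj (\sum_j f j) = \sum_j spinor_conj (f j).
Proof. exact: (big_morph _ spinor_conjD spinor_conj_zero). Qed.

(** [sigma_1] and [sigma_3] are real and anticommute with [sigma_2], while [sigma_2] is imaginary
    and commutes with itself; each Pauli matrix thus picks up exactly one sign. *)
Lemma spinor_conj_pauli {R : realType} (j : 'I_3) (s : spinor R) :
  spinor_conj (pauli j *m s) = - (pauli j *m spinor_conj s).
Proof.
rewrite /spinor_conj map_mxM -scalemxAr -scalerN !mulmxA -mulNmx; congr (_ *: (_ *m _)).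
apply/matrixP => a b; rewrite !mxE !big_ord_recl !big_ord0.
by case: (ord3P j) => ->; case: (ord2P a) => ->; case: (ord2P b) => ->;
  rewrite /pauli /= !mxE /=; simpc.
Qed.

Lemma spinor_conjK {R : realType} (s : spinor R) :
  spinor_conj (spinor_conj s) = - s.
Proof.
apply/colP => k; rewrite [RHS]mxE; case: (ord2P k) => ->.
  by rewrite spinor_conj0 spinor_conj1 rmorphN/= conjcK.
by rewrite spinor_conj1 spinor_conj0 conjcK.
Qed.

Lemma charge_conjE {R : realType} (psi : sfield R) x :
  charge_conj psi x = spinor_conj (psi x).
Proof. by []. Qed.

Lemma charge_conjK {R : realType} (psi : sfield R) :
  charge_conj (charge_conj psi) = fun x => - psi x.
Proof. by apply/funext => x; rewrite !charge_conjE spinor_conjK. Qed.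

(** Makes C bijective, with inverse C^3; images and preimages under C are handled through this. *)
Lemma charge_conj4 {R : realType} (psi : sfield R) :
  charge_conj (charge_conj (charge_conj (charge_conj psi))) = psi.
Proof. by rewrite !charge_conjK; apply/funext => x; rewrite opprK. Qed.

(** C is antiunitary: it swaps and conjugates the coordinates, and the minus sign occurs in both
    factors. *)
Lemma hdot_conj {R : realType} (s t : spinor R) :
  hdot (spinor_conj s) (spinor_conj t) = conjc (hdot s t).
Proof.
rewrite /hdot !big_ord_recl !big_ord0 !addr0.
have -> : lift ord0 ord0 = 1 :> 'I_2 by apply: val_inj.
rewrite !spinor_conj0 !spinor_conj1 rmorphD !rmorphM rmorphN mulrNN /=.
by rewrite addrC.
Qed.

(* [spinor_conj] swaps the two coordinates, up to a sign on either the real or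
   the imaginary part. *)
Lemma coord_conj {R : realType} (k : 'I_2) : exists l : 'I_2,
  (forall s : spinor R, re_coord k (spinor_conj s) = re_coord l s /\
                        im_coord k (spinor_conj s) = - im_coord l s) \/
  (forall s : spinor R, re_coord k (spinor_conj s) = - re_coord l s /\
                        im_coord k (spinor_conj s) = im_coord l s).
Proof.
rewrite /re_coord /im_coord; case: (ord2P k) => ->.
  by exists 1; left => s; rewrite spinor_conj0; case: (s 1 0).
by exists 0; right => s; rewrite spinor_conj1; case: (s 0 0) => a b /=;
  rewrite opprK.
Qed.

(* No derivability is needed: the junk value of ['D_v] is 0. *)
Lemma derive_opp {R : realType} {V : normedModType R} (f : V -> R^o) (x v : V) :
  'D_v (fun y => - f y) x = - 'D_v f x.
Proof.
have [df|ndf] := pselect (derivable f x v); first exact: deriveN.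
rewrite /derive (_ : (fun h => _) =
  - (fun h : R => h^-1 *: ((f \o shift x) (h *: v) - f x))); last first.
  by apply/funext => h; rewrite !fctE /= -scalerN opprB opprK addrC.
have nd : ~ cvg ((- (fun h : R => h^-1 *: ((f \o shift x) (h *: v) - f x)))
    @ 0^') by rewrite is_cvgNE.
by rewrite (dvgP ndf) (dvgP nd) -[LHS]oppr0.
Qed.

Lemma times_differentiableN {R : realType} {V : normedModType R} (k : nat)
    (U : set V) (f : V -> R^o) :
  times_differentiable k U f -> times_differentiable k U (fun x => - f x).
Proof.
elim: k f => [//|k IH] f /= [fU fD]; split=> [x Ux|v].
  exact/differentiableN/fU.
by rewrite (funext (fun x => derive_opp f x v)); exact/IH/fD.
Qed.

Lemma ssmooth_conj {R : realType} (Omega : set (vec R)) (psi : sfield R) :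
  ssmooth Omega psi -> ssmooth Omega (charge_conj psi).
Proof.
move=> psiO k; have [l [kl|kl]] := coord_conj (R := R) k;
  have [re im] := psiO l; split=> n.
- by under eq_fun do rewrite (kl _).1; exact: re.
- by under eq_fun do rewrite (kl _).2; exact/times_differentiableN/im.
- by under eq_fun do rewrite (kl _).1; exact/times_differentiableN/re.
- by under eq_fun do rewrite (kl _).2; exact: im.
Qed.

(** The derivative acts on real coordinates, which C only permutes up to sign. In the zeroth order
    term the coefficients are real and the signs from the two Pauli matrices cancel. *)
Lemma spin_nabla_conj {R : realType} (e : 'I_3 -> vec R -> vec R) (v : vec R)
    (psi : sfield R) (x : vec R) :
  spin_nabla e v (charge_conj psi) x = spinor_conj (spin_nabla e v psi x).
Proof.
rewrite /spin_nabla spinor_conjD; congr (_ + _).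
  apply/colP => k; rewrite mxE; case: (ord2P k) => ->.
    rewrite spinor_conj0 mxE /=; congr (_ +i* _).
      by congr ('D_v _ x); apply/funext => y; rewrite /re_coord spinor_conj0;
        case: (psi _ _ _).
    by rewrite -derive_opp; congr ('D_v _ x); apply/funext => y;
      rewrite /im_coord spinor_conj0; case: (psi _ _ _).
  rewrite spinor_conj1 mxE /=; congr (_ +i* _).
    by rewrite -derive_opp; congr ('D_v _ x); apply/funext => y;
      rewrite /re_coord spinor_conj1; case: (psi _ _ _).
  by rewrite opprK; congr ('D_v _ x); apply/funext => y;
    rewrite /im_coord spinor_conj1; case: (psi _ _ _) => a b /=; rewrite opprK.
rewrite spinor_conj_sum; apply: eq_bigr => k _.
rewrite spinor_conj_sum; apply: eq_bigr => l _.
rewrite spinor_conjZ conjc_real -!mulmxA !spinor_conj_pauli mulmxN opprK.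
by rewrite charge_conjE.
Qed.

(** The sign from the single Pauli matrix cancels the one from conjugating [- 'i]. *)
Lemma dirac_op_conj {R : realType} (e : 'I_3 -> vec R -> vec R)
    (psi : sfield R) (x : vec R) :
  dirac_op e (charge_conj psi) x = spinor_conj (dirac_op e psi x).
Proof.
rewrite /dirac_op spinor_conjZ spinor_conj_sum rmorphN /=.
under [in RHS]eq_bigr do rewrite spinor_conj_pauli.
rewrite sumrN scalerN -scaleNr; congr (_ *: _).
  by simpc.
by apply: eq_bigr => j _; rewrite spin_nabla_conj.
Qed.

Lemma l2sq_conj {R : realType} (psi : sfield R) :
  l2sq (charge_conj psi) = l2sq psi.
Proof.
rewrite /l2sq; apply: eq_integral => y _.
by rewrite !charge_conjE hdot_conj; case: (hdot _ _).
Qed.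

Lemma l2_conj {R : realType} (psi : sfield R) : l2 psi -> l2 (charge_conj psi).
Proof.
move=> [mpsi psi2]; split; last by rewrite l2sq_conj.
move=> k; have [l [kl|kl]] := coord_conj (R := R) k; have [re im] := mpsi l.
- split; first by rewrite (funext (fun y => (kl (psi (stereo_inv y))).1)).
  rewrite (funext (fun y => (kl (psi (stereo_inv y))).2)).
  exact: measurable_funN.
- split; last first.
  by rewrite (funext (fun y => (kl (psi (stereo_inv y))).2)).
  rewrite (funext (fun y => (kl (psi (stereo_inv y))).1)).
  exact: measurable_funN.
Qed.

(** Negation exchanges the positive and negative parts. This covers non-integrable [f] too: if
    either part has infinite integral, both sides are the default value 0. *)
Lemma sphere_intN {R : realType} (f : vec R -> R) :
  sphere_int (fun x => - f x) = - sphere_int f.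
Proof.
rewrite /sphere_int /Rintegral.
under eq_integral do rewrite mulNr EFinN.
set g := fun y => (f (stereo_inv y) * vol_density y)%:E.
rewrite (integralE lebesgue3 setT (fun y => - g y)%E) (integralE lebesgue3 setT g).
rewrite funeposN funenegN.
case: (\int[lebesgue3]_x g^\+ x)%E => [a| |];
  by case: (\int[lebesgue3]_x g^\- x)%E => [b| |] //=; rewrite ?oppr0 ?opprB.
Qed.

Lemma l2dot_conj {R : realType} (psi phi : sfield R) :
  l2dot (charge_conj psi) (charge_conj phi) = conjc (l2dot psi phi).
Proof.
rewrite /l2dot /=; congr (_ +i* _).
  by congr sphere_int; apply/funext => x; rewrite !charge_conjE hdot_conj;
    case: (hdot _ _).
by rewrite -sphere_intN; congr sphere_int; apply/funext => x;
  rewrite !charge_conjE hdot_conj; case: (hdot _ _).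
Qed.

(** * The Dirac operators *)

Lemma geoN {R : realType} (p v : vec R) (t : R) : geo p (- v) t = geo p v (- t).
Proof. by rewrite /geo cosN sinN scalerN scaleNr. Qed.

Lemma has_trace_opp {R : realType} (S : oriented_surface R) (sgn : R)
    (psi g : sfield R) :
  has_trace (opp_surface S) sgn psi g <-> has_trace S (- sgn) psi g.
Proof.
(* [tends] isolates the approach map, so that both sides become the same statement once the two maps
   are shown equal. *)
pose tends (f : vec R * R^o -> spinor R) := forall p k, surf S p ->
  let side := within [set qt : vec R * R^o | surf S qt.1 /\ 0 < qt.2]
                     (nbhs (p, 0 : R^o)) in
  (fun qt => re_coord k (f qt) : R^o) @ side --> re_coord k (g p) /\
  (fun qt => im_coord k (f qt) : R^o) @ side --> im_coord k (g p).
rewrite -[X in X <-> _]/(tends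
  (fun qt => psi (geo qt.1 (- normal S qt.1) (sgn * qt.2)))).
rewrite -[X in _ <-> X]/(tends
  (fun qt => psi (geo qt.1 (normal S qt.1) (- sgn * qt.2)))).
rewrite (_ : (fun qt => _) =
  fun qt => psi (geo qt.1 (normal S qt.1) (- sgn * qt.2))) //.
by apply/funext => qt; rewrite geoN mulNr.
Qed.

Lemma has_trace_conj {R : realType} (S : oriented_surface R) (sgn : R)
    (psi g : sfield R) :
  has_trace S sgn psi g -> has_trace S sgn (charge_conj psi) (charge_conj g).
Proof.
move=> tr p k Sp side psi_near; rewrite !charge_conjE.
have [l [kl|kl]] := coord_conj (R := R) k; have [re im] := tr p l Sp.
- rewrite (kl _).1 (kl _).2; split.
    by under eq_fun do rewrite (kl _).1.
  under eq_fun do rewrite (kl _).2.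
  exact: cvgN.
- rewrite (kl _).1 (kl _).2; split.
    under eq_fun do rewrite (kl _).1.
    exact: cvgN.
  by under eq_fun do rewrite (kl _).2.
Qed.

Lemma scontinuous_conj {R : realType} (S : set (vec R)) (g : sfield R) :
  scontinuous S g -> scontinuous S (charge_conj g).
Proof.
move=> cg k; have [l [kl|kl]] := coord_conj (R := R) k; have [re im] := cg l.
- rewrite (funext (fun y => (kl (g y)).1)) (funext (fun y => (kl (g y)).2)).
  by split=> // x; apply: cvgN; exact: im.
- rewrite (funext (fun y => (kl (g y)).1)) (funext (fun y => (kl (g y)).2)).
  by split=> // x; apply: cvgN; exact: re.
Qed.

Definition opp_potential {R : realType} (A : potential R) : potential R :=
  Potential (opp_surface (pot_surf A)) (pot_flux A).

Definition conj_potential {R : realType} (A : potential R) : potential R :=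
  Potential (opp_surface (pot_surf A)) (1 - pot_flux A).

Lemma opp_surfaceK {R : realType} : involutive (@opp_surface R).
Proof.
by case=> S n; congr OrientedSurface; apply/funext => x /=; rewrite opprK.
Qed.

Lemma opp_potentialK {R : realType} : involutive (@opp_potential R).
Proof. by case=> S a; rewrite /opp_potential /= opp_surfaceK. Qed.

Lemma conj_potentialK {R : realType} : involutive (@conj_potential R).
Proof. by case=> S a; rewrite /conj_potential /= opp_surfaceK subKr. Qed.

Lemma spinor_conj_eq0 {R : realType} (s : spinor R) :
  (spinor_conj s == 0) = (s == 0).
Proof.
apply/eqP/eqP => [s0|->]; last exact: spinor_conj_zero.
by apply/oppr_inj; rewrite oppr0 -spinor_conjK s0 spinor_conj_zero.
Qed.

(** Reversing the normal exchanges the two traces, which inverts the phase of the jump;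
    antilinearity of C inverts it back, so the flux stays the same. *)
Lemma core_dom_conj {R : realType} (A : potential R) (psi : sfield R) :
  core_dom A psi -> core_dom (opp_potential A) (charge_conj psi).
Proof.
move=> [smo supp [gp [gm [tp tm cp cm jump]]]]; split=> /=.
- exact: ssmooth_conj.
- rewrite -[RHS]supp; congr (closure _ `&` _); apply/seteqP.
  by split=> x /=; rewrite charge_conjE spinor_conj_eq0.
- exists (charge_conj gm), (charge_conj gp); split.
  + exact/has_trace_opp/has_trace_conj.
  + by apply/has_trace_opp; rewrite opprK; exact: has_trace_conj.
  + exact: scontinuous_conj.
  + exact: scontinuous_conj.
  (* The claim reduces to the phase times its conjugate being 1. *)
  + move=> p Sp; rewrite !charge_conjE (jump p Sp) spinor_conjZ scalerA /=.
    rewrite -[LHS]scale1r; congr (_ *: _); simpc.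
    by rewrite -!expr2 cos2Dsin2 addrC mulrC subrr.
Qed.

(** Here only the exchange of traces inverts the phase, and [exp (2 i pi alpha)] equals
    [exp (- 2 i pi (1 - alpha))]. *)
Lemma core_dom_conj_potential {R : realType} (A : potential R) (psi : sfield R) :
  core_dom A psi -> core_dom (conj_potential A) psi.
Proof.
move=> [smo supp [gp [gm [tp tm cp cm jump]]]]; split=> //=.
exists gm, gp; split=> //.
- exact/has_trace_opp.
- by apply/has_trace_opp; rewrite opprK.
move=> p Sp; rewrite (jump p Sp) scalerA.
set t := 2 * pi * pot_flux A.
rewrite (_ : - (2 * pi * (1 - pot_flux A)) = t - pi *+ 2); last first.
  by rewrite /t; ring.
rewrite cosB sinB cos2pi sin2pi !mulr0 !mulr1 addr0 subr0 cosN sinN.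
rewrite -[LHS]scale1r; congr (_ *: _); simpc.
by rewrite -!expr2 cos2Dsin2 [sin t * _]mulrC addNr.
Qed.

Lemma D_core_conj_potential {R : realType} (e : 'I_3 -> vec R -> vec R)
    (A : potential R) : D_core e (conj_potential A) = D_core e A.
Proof.
have core B : D_core e B `<=` D_core e (conj_potential B).
  by move=> z [dom l1 l2 act]; split=> //; exact: core_dom_conj_potential.
apply/seteqP; split=> [z|]; last exact: core.
by move=> /core; rewrite conj_potentialK.
Qed.

(** * Charge conjugation on graphs, closures and adjoints *)

Definition conj_pair {R : realType} (w : sfield R * sfield R) :=
  (charge_conj w.1, charge_conj w.2).

(* Stated in both directions so as not to use that D is stable under -1 = C^2. *)
Definition conj_intertwines {R : realType} (D D' : operator R) : Prop :=
  (forall w, D w -> D' (conj_pair w)) /\ (forall w, D' w -> D (conj_pair w)).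

Lemma conj_pair4 {R : realType} (w : sfield R * sfield R) :
  conj_pair (conj_pair (conj_pair (conj_pair w))) = w.
Proof. by case: w => psi phi; congr pair; exact: charge_conj4. Qed.

Lemma conj_intertwines_sym {R : realType} (D D' : operator R) :
  conj_intertwines D D' -> conj_intertwines D' D.
Proof. by case. Qed.

(* As [C^4 = 1], the converse implication is [C^3] applied to [D']. *)
Lemma conj_intertwinesE {R : realType} (D D' : operator R) w :
  conj_intertwines D D' -> D w <-> D' (conj_pair w).
Proof.
move=> [DD' D'D]; split=> [/DD'//|/D'D/DD'/D'D].
by rewrite conj_pair4.
Qed.

Lemma D_core_conj {R : realType} (e : 'I_3 -> vec R -> vec R)
    (A : potential R) :
  conj_intertwines (D_core e A) (D_core e (opp_potential A)).
Proof.
have core B w : D_core e B w -> D_core e (opp_potential B) (conj_pair w).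
  move=> [dom l1 l2 act]; split.
  - exact: core_dom_conj.
  - exact: l2_conj.
  - exact: l2_conj.
  - by move=> x Ox; rewrite dirac_op_conj -(act x Ox).
split=> w; first exact: core.
move=> /core; rewrite opp_potentialK; exact.
Qed.

Lemma charge_conjB {R : realType} (psi phi : sfield R) :
  (fun x => charge_conj psi x - charge_conj phi x) =
  charge_conj (fun x => psi x - phi x).
Proof.
by apply/funext => x; rewrite !charge_conjE spinor_conjD spinor_conjN.
Qed.

(** C is additive and preserves [l2sq], so it carries approximating pairs to approximating pairs. *)
Lemma op_closure_conj {R : realType} (D D' : operator R) :
  conj_intertwines D D' -> conj_intertwines (op_closure D) (op_closure D').
Proof.
have clos (E E' : operator R) w : (forall w, E w -> E' (conj_pair w)) ->
    op_closure E w -> op_closure E' (conj_pair w).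
  move=> EE' [l1 [l2 cl]]; split; first exact: l2_conj.
  split; first exact: l2_conj.
  move=> eps /cl[z [Ez zw]]; exists (conj_pair z); split; first exact: EE'.
  rewrite -(l2sq_conj (fun x => z.1 x - w.1 x)) in zw.
  rewrite -(l2sq_conj (fun x => z.2 x - w.2 x)) -!charge_conjB in zw.
  exact: zw.
by move=> [DD' D'D]; split=> w; exact: clos.
Qed.

Lemma conj_intertwines_preimage {R : realType} (D D' : operator R) w :
  conj_intertwines D D' -> D' w -> exists2 z, D z & w = conj_pair z.
Proof.
move=> [DD' D'D] D'w; exists (conj_pair (conj_pair (conj_pair w))).
  exact: (D'D _ (DD' _ (D'D _ D'w))).
exact: (esym (conj_pair4 w)).
Qed.

(** Every test pair of the second operator is the conjugate of one of the first, and on conjugates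
    the defining identity of the adjoint is merely complex conjugated. *)
Lemma op_adjoint_conj {R : realType} (D D' : operator R) :
  conj_intertwines D D' -> conj_intertwines (op_adjoint D) (op_adjoint D').
Proof.
have adj (E E' : operator R) w : conj_intertwines E E' ->
    op_adjoint E w -> op_adjoint E' (conj_pair w).
  move=> EE' [l1 [l2 sym]]; split; first exact: l2_conj.
  split; first exact: l2_conj.
  move=> _ /(conj_intertwines_preimage _ _ _ EE')[y /sym sy ->].
  by rewrite [LHS]l2dot_conj [RHS]l2dot_conj sy.
by move=> DD'; split=> w; apply: adj => //; exact/conj_intertwines_sym.
Qed.

Lemma op_dom_conj {R : realType} (D D' : operator R) (psi : sfield R) :
  conj_intertwines D D' -> op_dom D psi <-> op_dom D' (charge_conj psi).
Proof.
move=> DD'; split=> [[phi Dphi]|[phi Dphi]].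
  by exists (charge_conj phi); exact: (DD'.1 (psi, phi)).
have [[psi' phi'] /= Dp [eq_psi _]] := conj_intertwines_preimage _ _ _ DD' Dphi.
exists phi'; rewrite -[psi]charge_conj4 eq_psi charge_conj4; exact: Dp.
Qed.

(** * Independence of the values off the sphere *)

Lemma sphere_stereo_inv {R : realType} (y : R * R * R) : sphere (stereo_inv y).
Proof.
rewrite /sphere /= /dotv !big_ord_recl big_ord0 !mxE /=.
set s := sqnorm3 y.
have s1 : 1 + s != 0.
  by rewrite gt_eqF// ltr_pwDl// !addr_ge0 ?sqr_ge0.
have -> : s = y.1.1 ^+ 2 + y.1.2 ^+ 2 + y.2 ^+ 2 by [].
move: s1; rewrite /s /sqnorm3 => s1; field.
exact: s1.
Qed.

Lemma eq_l2sq {R : realType} (psi phi : sfield R) :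
  (forall x, sphere x -> psi x = phi x) -> l2sq psi = l2sq phi.
Proof.
by move=> eqS; apply: eq_integral => y _; rewrite eqS//; exact: sphere_stereo_inv.
Qed.

Lemma eq_l2 {R : realType} (psi phi : sfield R) :
  (forall x, sphere x -> psi x = phi x) -> l2 psi -> l2 phi.
Proof.
move=> eq_psi [mpsi psi2]; split; last by rewrite -(eq_l2sq psi).
have eqS y := eq_psi _ (sphere_stereo_inv y).
move=> k; have [re im] := mpsi k.
by split; [rewrite -(funext (fun y => congr1 (re_coord k) (eqS y)))
          |rewrite -(funext (fun y => congr1 (im_coord k) (eqS y)))].
Qed.

(** Spinors are functions on all of R^4, but the localized projections of the boundary conditions
    can be compared only on the sphere. The L^2 quantities sample points of the sphere alone. *)
Lemma eq_op_closure_dom {R : realType} (D : operator R) (psi phi : sfield R) :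
  (forall x, sphere x -> psi x = phi x) ->
  op_dom (op_closure D) psi <-> op_dom (op_closure D) phi.
Proof.
have impl (f g : sfield R) : (forall x, sphere x -> f x = g x) ->
    op_dom (op_closure D) f -> op_dom (op_closure D) g.
  move=> fg [h [l1 [l2 cl]]]; exists h; split; first exact: (eq_l2 f).
  split; first exact: l2.
  move=> eps /cl[z [Dz zf]]; exists z; split; first exact: Dz.
  have zfg x : sphere x -> z.1 x - f x = z.1 x - g x by move=> Sx; rewrite fg.
  by rewrite -(eq_l2sq _ _ zfg).
move=> eqS; split; apply: impl => // x Sx.
by rewrite eqS.
Qed.

(** * Transfer to the minimal operators and their extensions *)

Lemma D_min_conj {R : realType} (e : 'I_3 -> vec R -> vec R)
    (A : potential R) :
  conj_intertwines (D_min e A) (D_min e (opp_potential A)).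
Proof. exact/op_closure_conj/D_core_conj. Qed.

Lemma D_ext_conj {R : realType} (e : 'I_3 -> vec R -> vec R) (chi : R -> R)
    (delta : R) (xi xi' : sfield R) (A : potential R) :
  let K := boundary (surf (pot_surf A)) in
  (forall psi x, sphere x ->
    charge_conj (cutoff_proj chi delta K xi psi) x =
    cutoff_proj chi delta K xi' (charge_conj psi) x) ->
  forall w, D_ext e chi delta xi A w <->
            D_ext e chi delta xi' (opp_potential A) (conj_pair w).
Proof.
move=> K eqP w; have DD' := D_min_conj e A.
rewrite /D_ext /op_restrict /=.
have adj := conj_intertwinesE _ _ w (op_adjoint_conj _ _ DD').
have dom := op_dom_conj _ _ (cutoff_proj chi delta K xi w.1) DD'.
have clo := eq_op_closure_dom (D_core e (opp_potential A)) _ _ (eqP w.1).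
split=> -[adjw domw].
  by split; [exact: (adj.1 adjw)|exact: (clo.1 (dom.1 domw))].
by split; [exact: (adj.2 adjw)|exact: (dom.2 (clo.2 domw))].
Qed.

(** The minimal operators of [A] and [conj_potential A] coincide, hence so do their adjoints; only
    the spinor in the boundary condition differs. *)
Lemma D_ext_conj_potential {R : realType} (e : 'I_3 -> vec R -> vec R)
    (chi : R -> R) (delta : R) (xi xi' : sfield R) (A : potential R) :
  let K := boundary (surf (pot_surf A)) in
  (forall psi x, sphere x ->
    cutoff_proj chi delta K xi psi x = cutoff_proj chi delta K xi' psi x) ->
  D_ext e chi delta xi A = D_ext e chi delta xi' (conj_potential A).
Proof.
move=> K eqP; rewrite /D_ext /D_min D_core_conj_potential.
by apply/seteqP; split=> w [adjw /(eq_op_closure_dom _ _ _ (eqP w.1)) domw].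
Qed.

Lemma cutoff_proj_conj {R : realType} (chi : R -> R) (delta : R)
    (K : set (vec R)) (xi psi : sfield R) :
  charge_conj (cutoff_proj chi delta K xi psi) =
  cutoff_proj chi delta K (charge_conj xi) (charge_conj psi).
Proof.
apply/funext => x; rewrite charge_conjE /cutoff_proj spinor_conjZ; congr (_ *: _).
by rewrite -hdot_conj spinor_conjZ conjc_real.
Qed.

(** * Parallel transport along normal geodesics *)

Lemma dotvC {R : realType} (u v : vec R) : dotv u v = dotv v u.
Proof. by apply: eq_bigr => i _; rewrite mulrC. Qed.

Lemma dotvDl {R : realType} (u v w : vec R) :
  dotv (u + v) w = dotv u w + dotv v w.
Proof.
by rewrite /dotv -big_split; apply: eq_bigr => i _; rewrite !mxE mulrDl.
Qed.

Lemma dotvZl {R : realType} (a : R) (u w : vec R) :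
  dotv (a *: u) w = a * dotv u w.
Proof.
by rewrite /dotv mulr_sumr; apply: eq_bigr => i _; rewrite !mxE mulrA.
Qed.

Lemma dotvDr {R : realType} (u v w : vec R) :
  dotv w (u + v) = dotv w u + dotv w v.
Proof. by rewrite dotvC dotvDl !(dotvC w). Qed.

Lemma dotvZr {R : realType} (a : R) (u w : vec R) :
  dotv w (a *: u) = a * dotv w u.
Proof. by rewrite dotvC dotvZl !(dotvC w). Qed.

Lemma dotvNl {R : realType} (u w : vec R) : dotv (- u) w = - dotv u w.
Proof. by rewrite -scaleN1r dotvZl mulN1r. Qed.

Lemma dotvNr {R : realType} (u w : vec R) : dotv w (- u) = - dotv w u.
Proof. by rewrite dotvC dotvNl dotvC. Qed.

Lemma dotv0l {R : realType} (w : vec R) : dotv 0 w = 0.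
Proof. by rewrite -(scale0r 0) dotvZl mul0r. Qed.

Lemma dotv_ge0 {R : realType} (u : vec R) : 0 <= dotv u u.
Proof. by apply: sumr_ge0 => i _; rewrite -expr2 sqr_ge0. Qed.

Lemma dotv_eq0 {R : realType} (u : vec R) : dotv u u = 0 -> u = 0.
Proof.
move=> /eqP; rewrite psumr_eq0 => [/allP u0|i _]; last first.
  by rewrite -expr2 sqr_ge0.
apply/rowP => i; rewrite mxE; apply/eqP.
by have := u0 i (mem_index_enum _); rewrite mulf_eq0 orbb.
Qed.

(** Expand the squared lengths of [u + v] and [u - v]. *)
Lemma dotv_sphere {R : realType} (u v : vec R) :
  sphere u -> sphere v -> -1 <= dotv u v <= 1.
Proof.
rewrite /sphere /= => uu vv; have := dotv_ge0 (u + v); have := dotv_ge0 (u - v).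
rewrite !dotvDl !dotvDr !dotvNl !dotvNr uu vv (dotvC v u); lra.
Qed.

Lemma dotv_sphere_eq {R : realType} (u v : vec R) :
  sphere u -> sphere v -> dotv u v = 1 -> u = v.
Proof.
rewrite /sphere /= => uu vv uv; apply/eqP; rewrite -subr_eq0; apply/eqP.
apply: dotv_eq0; rewrite !dotvDl !dotvDr !dotvNl !dotvNr uu vv (dotvC v u) uv.
lra.
Qed.

Lemma is_derive_row {R : realType} (f : R -> vec R) (t : R) (df : vec R) :
  is_derive t 1 f df <->
  forall i, is_derive t 1 (fun s => f s 0 i) (df 0 i).
Proof.
split=> [[fd <-] i|fd].
  split; first exact: (derivable_mxP _ _ _).1.
  by rewrite derive_mx// mxE.
have fD : derivable f t 1.
  by apply/derivable_mxP => i j; rewrite (ord1 i); have [] := fd j.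
split=> //; rewrite derive_mx//; apply/rowP => i; rewrite mxE.
by have [] := fd i.
Qed.

Lemma is_derive_mul {R : realType} (f g : R -> R) (t df dg : R) :
  is_derive t 1 f df -> is_derive t 1 g dg ->
  is_derive t 1 (fun s => f s * g s) (df * g t + f t * dg).
Proof.
move=> fd gd; rewrite -[fun s => _]/(f * g).
by apply: is_derive_eq; rewrite addrC mulrC.
Qed.

Lemma is_derive_dotv {R : realType} (f g : R -> vec R) (t : R) (df dg : vec R) :
  is_derive t 1 f df -> is_derive t 1 g dg ->
  is_derive t 1 (fun s => dotv (f s) (g s)) (dotv df (g t) + dotv (f t) dg).
Proof.
move=> /is_derive_row fd /is_derive_row gd.
rewrite (_ : (fun s => _) = \sum_i (fun s => f s 0 i * g s 0 i)); last first.
  by apply/funext => s; rewrite fct_sumE.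
rewrite /dotv -big_split; apply: is_derive_sum => i.
exact: is_derive_mul.
Qed.

Lemma geo0 {R : realType} (p v : vec R) : geo p v 0 = p.
Proof. by rewrite /geo cos0 sin0 scale1r scale0r addr0. Qed.

Lemma is_derive_geo {R : realType} (p v : vec R) (t : R) :
  is_derive t 1 (geo p v) (geo_velocity p v t).
Proof.
apply/is_derive_row => i; rewrite /geo /geo_velocity.
rewrite (_ : (fun s => _) = p 0 i \*: (@cos R) + v 0 i \*: (@sin R)); last first.
  by apply/funext => s; rewrite !mxE /= !fctE; congr (_ + _); rewrite mulrC.
rewrite !mxE; apply: is_derive_eq; rewrite -![_ *: _]/(_ * _).
ring.
Qed.

Lemma dotv_geo {R : realType} (p v : vec R) (t : R) :
  dotv p p = 1 -> dotv v v = 1 -> dotv v p = 0 ->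
  dotv (geo p v t) (geo p v t) = 1 /\ dotv (geo p v t) (geo_velocity p v t) = 0.
Proof.
move=> pp vv vp; rewrite /geo /geo_velocity.
rewrite !(dotvDl, dotvDr, dotvNl, dotvNr, dotvZl, dotvZr) (dotvC p v) vp pp vv.
by split; [rewrite -[RHS](cos2Dsin2 t)|]; ring.
Qed.

Lemma radial_sphere {R : realType} (x : vec R) : sphere x -> radial x = x.
Proof. by rewrite /radial /enorm => ->; rewrite sqrtr1 invr1 scale1r. Qed.

Lemma cone_sphere {R : realType} (Omega : set (vec R)) (x : vec R) :
  sphere x -> Omega x -> cone Omega x.
Proof.
move=> Sx Ox; split; last by rewrite radial_sphere.
apply/eqP => x0; move: Sx; rewrite /sphere /= x0 /dotv big1 => [/eqP|i _].
  by rewrite eq_sym oner_eq0.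
by rewrite mxE mul0r.
Qed.

Lemma derive0_constant {R : realType} (f : R -> R) (t : R) : 0 <= t ->
  (forall s : R, 0 <= s <= t -> is_derive s 1 f 0) -> f t = f 0.
Proof.
rewrite le_eqVlt => /predU1P[<-//|t0] fd.
have [||c _] := @MVT _ f (fun=> 0) 0 t t0.
- by move=> x /[!in_itv]/= /andP[x0 xt]; apply: fd; rewrite !ltW.
- apply: derivable_within_continuous => x /[!in_itv]/= xt.
  by have [] := fd x xt.
by rewrite mul0r => /eqP; rewrite subr_eq0 => /eqP.
Qed.

Lemma is_derive_along_geo {R : realType} (X : vec R -> vec R) (p v : vec R)
    (t : R) :
  differentiable X (geo p v t) ->
  is_derive t 1 (X \o geo p v) ('D_(geo_velocity p v t) X (geo p v t)).
Proof.
move=> dX; have [geo_d geo_v] := is_derive_geo p v t.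
have dgeo : differentiable (geo p v) t by exact/derivable1_diffP.
split; first exact/derivable1_diffP/differentiable_comp.
rewrite deriveE; last exact: differentiable_comp.
by rewrite (diff_comp dgeo dX) -[LHS]/('d X _ ('d (geo p v) t 1)) -(deriveE _ dgeo) geo_v -deriveE.
Qed.

(* Both [<Y, geo>] and then [<Y, Y>] have zero derivative along the geodesic. *)
Lemma parallel_eq0 {R : realType} (Y : vec R -> vec R) (p v : vec R) (t : R) :
  dotv p p = 1 -> dotv v v = 1 -> dotv v p = 0 -> 0 <= t ->
  (forall s : R, 0 <= s <= t -> differentiable (Y \o radial) (geo p v s)) ->
  (forall s : R, 0 <= s <= t -> lc_nabla (geo_velocity p v s) Y (geo p v s) = 0) ->
  Y p = 0 -> Y (geo p v t) = 0.
Proof.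
move=> pp vv vp t0 dY nY Yp.
pose y := (Y \o radial) \o geo p v.
have yE (s : R) : y s = Y (geo p v s).
  by rewrite /y /= radial_sphere//; exact: (dotv_geo _ _ _ pp vv vp).1.
(* The tangential part of the derivative vanishes by parallelism, which leaves a multiple of the
   position vector. *)
have yd (s : R) : 0 <= s <= t ->
    is_derive s 1 y (- (dotv (geo_velocity p v s) (y s) *: geo p v s)).
  move=> st; apply: is_derive_eq; first exact/is_derive_along_geo/dY.
  by apply/eqP; rewrite -addr_eq0 yE; apply/eqP/nY.
have y_geo (s : R) : 0 <= s <= t -> dotv (y s) (geo p v s) = 0.
  move=> /andP[s0 st].
  transitivity (dotv (y 0) (geo p v 0)); last by rewrite yE geo0 Yp dotv0l.
  apply: (derive0_constant (fun s => dotv (y s) (geo p v s))) => // r.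
  move=> /andP[r0 rs]; apply: is_derive_eq.
    apply: is_derive_dotv; last exact: is_derive_geo.
    by apply: yd; rewrite r0 (le_trans rs).
  rewrite dotvNl dotvZl (dotv_geo _ _ _ pp vv vp).1 mulr1 dotvC addrC.
  by rewrite subrr.
apply: dotv_eq0; rewrite -yE.
transitivity (dotv (y 0) (y 0)); last by rewrite yE geo0 Yp dotv0l.
apply: (derive0_constant (fun s => dotv (y s) (y s))) => // r rt.
apply: is_derive_eq; first by apply: is_derive_dotv; exact: yd.
rewrite dotvNl dotvNr dotvZl dotvZr (y_geo r rt).
rewrite [dotv (geo _ _ _) _]dotvC (y_geo r rt).
by rewrite !mulr0 oppr0 addr0.
Qed.

Lemma lc_nablaD {R : realType} (v : vec R) (X Y : vec R -> vec R) (x : vec R) :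
  differentiable (X \o radial) x -> differentiable (Y \o radial) x ->
  lc_nabla v (fun x => X x + Y x) x = lc_nabla v X x + lc_nabla v Y x.
Proof.
move=> dX dY; rewrite /lc_nabla dotvDr scalerDl addrACA; congr (_ + _).
by rewrite -[_ \o radial]/((X \o radial) + (Y \o radial)) deriveD//;
  exact: diff_derivable.
Qed.

(** * Nearest points on the knot and the tube around it *)

Lemma periodic_int {R : realType} {T : Type} (c : R -> T) (t : R) (m : int) :
  (forall t, c (t + 1) = c t) -> c (t + m%:~R) = c t.
Proof.
move=> c1; have cn (n : nat) s : c (s + n%:R) = c s.
  by elim: n => [|n IH]; rewrite ?addr0// -[n.+1%:R]natr1 addrA c1.
case: m => n; first exact: cn.
by rewrite NegzE mulrNz -[LHS](cn n.+1) subrK.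
Qed.

(** Nearest means largest inner product with [x], and a maximum exists over one period. Criticality
    there gives orthogonality to the tangent. Excluding -1 keeps [p] from being antipodal to [x],
    where the joining geodesic would not be determined. *)
Lemma knot_nearest_point {R : realType} (g : oriented_curve R) (x : vec R) :
  is_knot g -> sphere x ->
  exists p, [/\ kset g p, sphere p, forall q, kset g q -> dotv x q <= dotv x p,
    dotv x (ktan g p) = 0 /\ dotv p (ktan g p) = 0 & dotv x p != -1].
Proof.
move=> [c [smo [per [_ [Sc [c' [-> tanE]]]]]]] Sx.
have cd (t : R) : is_derive t 1 (c : R -> vec R) (derive1 c t).
  split; last by rewrite derive1E.
  by apply/derivable1_diffP; exact: (smo 1%N).1.
pose f (t : R) : R := dotv x (c t).
have fd (t : R) : is_derive t 1 f (dotv x (derive1 c t)).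
  apply: is_derive_eq; first exact: (is_derive_dotv (cst x) c).
  by rewrite dotv0l add0r.
have f_cont : {within `[0, 1], continuous f}.
  by apply: derivable_within_continuous => t _; have [] := fd t.
have [t0 _ t0max] := EVT_max ler01 f_cont.
have fmax t : f t <= f t0.
  (* Periodicity moves the parameter into [0, 1], where [t0] is a maximum. *)
  have -> : f t = f (t - (Num.floor t)%:~R).
    by rewrite /f -mulrNz (periodic_int c).
  apply: t0max; rewrite in_itv /= subr_ge0 ge_floor lerBlDl.
  by have := floorD1_gt t; rewrite intrD1 => /ltW.
exists (c t0); split.
- by exists t0.
- exact: Sc.
- by move=> _ [t _ <-]; exact: fmax.
- rewrite tanE !dotvZr; split.
    have [|t _|||_ d0] := @derive1_at_max _ f (t0 - 1) (t0 + 1) t0.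
    + by lra.
    + by have [] := fd t.
    + by rewrite in_itv /=; lra.
    + by move=> t _; exact: fmax.
    + by have [_ <-] := fd t0; rewrite d0 mulr0.
  have [_] := is_derive_dotv c c t0 _ _ (cd t0) (cd t0).
  rewrite (_ : (fun t => dotv _ _) = cst 1); last first.
    by apply/funext => t; exact: Sc.
  rewrite derive_cst dotvC => d0.
  by rewrite (_ : dotv _ _ = 0) ?mulr0//; lra.
(* If the maximum were -1, every point of the knot would be [- x], and the parametrization would be
   constant despite its nonzero velocity. *)
- apply/eqP => ft0.
  have cE t : c t = - x.
    apply/esym/dotv_sphere_eq; [by rewrite /sphere /= dotvNl dotvNr opprK|exact: Sc|].
    have := fmax t; have := dotv_sphere x (c t) Sx (Sc t).
    rewrite /f ft0 dotvNl => /andP[ge le] le'.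
    by apply/eqP; rewrite eqr_oppLR eq_le le'.
  have := c' 0; rewrite (_ : c = cst (- x)); last exact/funext.
  by rewrite derive1_cst eqxx.
Qed.

Lemma knot_sphere {R : realType} (g : oriented_curve R) (p : vec R) :
  is_knot g -> kset g p -> sphere p.
Proof. by move=> [c [_ [_ [_ [Sc [_ [-> _]]]]]]] [t _ <-]; exact: Sc. Qed.

Lemma le_acos {R : realType} (a b : R) :
  -1 <= a <= 1 -> -1 <= b <= 1 -> a <= b -> acos b <= acos a.
Proof.
move=> a1 b1 ab; rewrite leNgt; apply/negP => lt_acos.
have ai : acos a \in `[0, pi] by rewrite in_itv/= acos_ge0//= acos_lepi.
have bi : acos b \in `[0, pi] by rewrite in_itv/= acos_ge0//= acos_lepi.
by move: lt_acos; rewrite -ltr_cos// !acosK ?in_itv// ltNge ab.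
Qed.

(** Join [x] to its nearest point on the knot: the great circle arc leaves the knot orthogonally and
    has length equal to the distance. *)
Lemma tube_geo {R : realType} (g : oriented_curve R) (eps : R) (x : vec R) :
  is_knot g -> tube g eps x -> exists p, [/\ kset g p, sphere p &
    x = p \/ exists v t, [/\ unit_normal_to g p v, 0 <= t < eps & x = geo p v t]].
Proof.
move=> kg [Sx xeps].
have [p [gp Sp near [xT pT] xp]] := knot_nearest_point g x kg Sx.
exists p; split=> //; set a := dotv x p in xp.
have a1 : -1 <= a <= 1 by exact: dotv_sphere.
have Kn0 : [set acos (dotv x p) | p in kset g] !=set0.
  by exists (acos a), p.
have [aeq|aneq] := eqVneq a 1; [left|right].
  exact: dotv_sphere_eq.
have {}a1 : -1 < a < 1 by rewrite !lt_neqAle aneq eq_sym xp.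
pose t := acos a; have t1 : 0 < t < pi.
  by have /andP[/ltW ? /ltW ?] := a1; rewrite acos_gt0 ?acos_ltpi//; lra.
have sint : sin t != 0 by rewrite gt_eqF// sin_gt0_pi.
have cost : cos t = a by rewrite /t acosK// in_itv /=; lra.
have := cos2Dsin2 t; rewrite cost => sin2.
(* The initial velocity is the normalized component of [x] orthogonal to [p]; its length before
   normalization is [sin t]. *)
exists ((sin t)^-1 *: (x - a *: p)), t; split.
- have xx : dotv x x = 1 by [].
  have pp : dotv p p = 1 by [].
  split.
  + rewrite dotvZl dotvZr dotvDl !dotvDr !dotvNl !dotvNr !dotvZl !dotvZr.
    rewrite xx (dotvC p) pp -/a.
    rewrite (_ : _ + _ = sin t ^+ 2); last by lra.
    by rewrite expr2 mulKf// mulVf.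
  + by rewrite dotvZl dotvDl dotvNl dotvZl pp -/a mulr1 subrr mulr0.
  + by rewrite dotvZl dotvDl dotvNl dotvZl xT pT mulr0 subr0 mulr0.
(* Some point [q] of the knot is at angle less than [eps] from [x], and [p] is at least as near. *)
- have [_ [q gq <-] q_eps] := inf_lt Kn0 xeps.
  have Sq := knot_sphere g q kg gq.
  rewrite ltW ?(andP t1).1//= (le_lt_trans _ q_eps)// /t le_acos//.
  + exact: dotv_sphere.
  + exact: dotv_sphere.
  + exact: near.
- by rewrite /geo cost scalerA divff// scale1r addrC subrK.
Qed.

Lemma acos_cos_le {R : realType} (s : R) : 0 <= s -> acos (cos s) <= s.
Proof.
move=> s0; have [spi|pis] := leP s pi; first by rewrite cosK// in_itv/= s0.
by rewrite (le_trans _ (ltW pis))// acos_lepi// cos_geN1 cos_le1.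
Qed.

(** The foot [p] already bounds the distance by [acos (cos t)], which is at most [t]. This makes the
    smoothness of frame fields available along the whole geodesic segment. *)
Lemma geo_tube {R : realType} (g : oriented_curve R) (eps : R) (p v : vec R)
    (t : R) :
  is_knot g -> kset g p -> unit_normal_to g p v -> 0 <= t < eps ->
  tube g eps (geo p v t).
Proof.
move=> kg gp [vv vp _] /andP[t0 teps].
have pp : dotv p p = 1 := knot_sphere g p kg gp.
have St : sphere (geo p v t) := (dotv_geo p v t pp vv vp).1.
split=> //; apply: le_lt_trans teps; apply: le_trans (acos_cos_le t t0).
apply: ge_inf.
  exists 0 => _ [q gq <-]; apply: acos_ge0; apply: dotv_sphere => //.
  exact: knot_sphere gq.
exists p => //; congr acos.
by rewrite /geo dotvDl !dotvZl pp vp mulr1 mulr0 addr0.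
Qed.

Lemma vsmooth_differentiable {R : realType} (Omega : set (vec R))
    (X : vec R -> vec R) (x : vec R) :
  vsmooth Omega X -> sphere x -> Omega x -> differentiable (X \o radial) x.
Proof. by move=> smo Sx Ox; apply: (smo 1%N).1; exact: cone_sphere. Qed.

Lemma parallel_opp {R : realType} (g : oriented_curve R) (eps : R)
    (X Y : vec R -> vec R) :
  is_knot g -> vsmooth (tube g eps) X -> vsmooth (tube g eps) Y ->
  vparallel g eps X -> vparallel g eps Y ->
  (forall p, kset g p -> X p = - Y p) ->
  forall x, tube g eps x -> X x = - Y x.
Proof.
move=> kg smoX smoY parX parY opp x xg.
have [p [gp Sp [->|[v [t [nv /andP[t0 teps] ->]]]]]] := tube_geo g eps x kg xg.
  exact: opp.
have [vv vp _] := nv.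
have tubes (s : R) : 0 <= s <= t -> tube g eps (geo p v s).
  by move=> /andP[s0 st]; apply: geo_tube; rewrite // s0 (le_lt_trans st).
have dX (s : R) : 0 <= s <= t -> differentiable (X \o radial) (geo p v s).
  by move=> /tubes ts; apply: (vsmooth_differentiable _ _ _ smoX) => //; case: ts.
have dY (s : R) : 0 <= s <= t -> differentiable (Y \o radial) (geo p v s).
  by move=> /tubes ts; apply: (vsmooth_differentiable _ _ _ smoY) => //; case: ts.
apply/eqP; rewrite -addr_eq0; apply/eqP.
(* The sum is parallel along the geodesic and vanishes at its foot on the knot. *)
apply: (parallel_eq0 (fun x => X x + Y x) p v t Sp vv vp t0).
- by move=> s st; rewrite -[_ \o radial]/((X \o radial) + (Y \o radial));
    apply: differentiableD; [exact: dX|exact: dY].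
- move=> s st; rewrite lc_nablaD; [|exact: dX|exact: dY].
  have s_eps : `|s| < eps.
    by move: st => /andP[s0 st]; rewrite ger0_norm// (le_lt_trans st).
  by rewrite parX// parY// addr0.
- by rewrite opp// addNr.
Qed.

Lemma vparallel_opp_curve {R : realType} (g : oriented_curve R) (eps : R)
    (X : vec R -> vec R) :
  vparallel (opp_curve g) eps X -> vparallel g eps X.
Proof.
move=> par p v t gp [vv vp vT]; apply: par => //.
by split=> //=; rewrite dotvNr vT oppr0.
Qed.

Lemma seifert_frame_opp {R : realType} (e : 'I_3 -> vec R -> vec R)
    (g : oriented_curve R) (S S' : oriented_surface R) (eps : R)
    (F F' : seifert_frame R) :
  is_knot g -> is_seifert_frame e g S eps F ->
  is_seifert_frame e (opp_curve g) S' eps F' ->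
  forall x, tube g eps x -> fT F' x = - fT F x.
Proof.
move=> kg hF hF'; have [smo _ _] := frame_vsmooth hF.
have [smo' _ _] := frame_vsmooth hF'.
have [par _ _] := frame_vparallel hF; have [par' _ _] := frame_vparallel hF'.
apply: parallel_opp => //; first exact: vparallel_opp_curve.
move=> p gp; have [-> _] := frame_tangent_normal hF gp.
by have [-> _] := frame_tangent_normal hF' gp.
Qed.

(** * Boundary conditions *)

(* Trace-free implies that the eigenspace is a line, and a line determines its
   orthogonal projection. *)
Lemma eigenspinor_projection {R : realType} (M : 'M[R[i]]_2)
    (s t psi : spinor R) :
  \tr M = 0 -> M *m s = - s -> M *m t = - t ->
  hdot s s = 1 -> hdot t t = 1 -> hdot s psi *: s = hdot t psi *: t.
Proof.
have sum2 (f : 'I_2 -> R[i]) : \sum_i f i = f 0 + f 1.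
  by rewrite big_ord_recl big_ord1; congr (_ + f _); apply: val_inj.
rewrite /hdot /mxtrace !sum2 => trM /colP Ms /colP Mt ss tt.
have := Ms 0; have := Ms 1; have := Mt 0; have := Mt 1.
rewrite !mxE !sum2 => Mt1 Mt0 Ms1 Ms0.
(* Proportionality of [s] and [t], as the vanishing of their 2 by 2 determinant. *)
have cross k l : s k 0 * t l 0 = s l 0 * t k 0.
  suff det0 : s 0 0 * t 1 0 = s 1 0 * t 0 0.
    by case: (ord2P k) => ->; case: (ord2P l) => ->.
  have two0 : (2 : R[i]) != 0 by rewrite pnatr_eq0.
  apply: (mulfI two0).
  have M11 : M 1 1 = - M 0 0 by apply/eqP; rewrite -addr_eq0 addrC trM.
  rewrite M11 in Mt1 Ms1; apply/eqP; rewrite -subr_eq0; apply/eqP.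
  (* With [M 1 1 = - M 0 0], this combination of the four eigenvalue equations cancels every entry
     of [M] and leaves twice the determinant. *)
  transitivity
    (t 1 0 * (M 0 0 * s 0 0 + M 0 1 * s 1 0 + s 0 0)
     - s 1 0 * (M 0 0 * t 0 0 + M 0 1 * t 1 0 + t 0 0)
     - t 0 0 * (M 1 0 * s 0 0 + - M 0 0 * s 1 0 + s 1 0)
     + s 0 0 * (M 1 0 * t 0 0 + - M 0 0 * t 1 0 + t 1 0)); first by ring.
  by rewrite Ms0 Ms1 Mt0 Mt1 !addNr !mulr0 !subr0 addr0.
have crossJ k l : conjc (s k 0) * conjc (t l 0) = conjc (s l 0) * conjc (t k 0).
  by rewrite -!rmorphM cross.
(* The rank one projections onto [s] and [t] have equal entries: insert the norm of [t], exchange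
   indices by proportionality, and remove the norm of [s]. *)
have eqP i j : conjc (s i 0) * s j 0 = conjc (t i 0) * t j 0.
  transitivity (conjc (s i 0) * conjc (t 0 0) * (s j 0 * t 0 0) +
                conjc (s i 0) * conjc (t 1 0) * (s j 0 * t 1 0)).
    by rewrite -[LHS]mulr1 -tt; ring.
  rewrite (crossJ i 0) (crossJ i 1) (cross j 0) (cross j 1).
  by rewrite -[RHS]mulr1 -ss; ring.
apply/colP => k; rewrite !mxE !mulrDl.
by congr (_ + _); rewrite ![_ * psi _ _ * _]mulrAC eqP.
Qed.

Lemma clifford_trace {R : realType} (e : 'I_3 -> vec R -> vec R) (x : vec R)
    (omega : vec R -> R) : \tr (clifford e x omega) = 0.
Proof.
rewrite /clifford raddf_sum big1 // => j _; rewrite /= mxtraceZ.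
suff -> : \tr (pauli j : 'M[R[i]]_2) = 0 by rewrite mulr0.
rewrite /mxtrace big_ord_recl big_ord1.
by case: (ord3P j) => ->; rewrite /pauli /= !mxE /= ?addr0// subrr.
Qed.

Lemma spinor_conj_clifford {R : realType} (e : 'I_3 -> vec R -> vec R)
    (x : vec R) (omega : vec R -> R) (s : spinor R) :
  spinor_conj (clifford e x omega *m s) = - (clifford e x omega *m spinor_conj s).
Proof.
rewrite /clifford !mulmx_suml spinor_conj_sum -sumrN; apply: eq_bigr => j _.
rewrite -!scalemxAl spinor_conjZ conjc_real spinor_conj_pauli.
by rewrite scalerN.
Qed.

Lemma cliffordN {R : realType} (e : 'I_3 -> vec R -> vec R) (x v : vec R) :
  clifford e x (dotv (- v)) = - clifford e x (dotv v).
Proof.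
rewrite /clifford -sumrN; apply: eq_bigr => j _.
by rewrite dotvNl rmorphN scaleNr.
Qed.

(** Inside the tube the projections agree by hypothesis; outside it the distance is at least [eps],
    hence exceeds [delta], and the cutoff vanishes. *)
Lemma eq_cutoff_proj {R : realType} (g : oriented_curve R) (chi : R -> R)
    (eps delta : R) (xi xi' : sfield R) :
  is_cutoff chi -> 0 < delta < eps ->
  (forall psi x, tube g eps x ->
    hdot (xi x) (psi x) *: xi x = hdot (xi' x) (psi x) *: xi' x) ->
  forall psi x, sphere x ->
    cutoff_proj chi delta (kset g) xi psi x =
    cutoff_proj chi delta (kset g) xi' psi x.
Proof.
move=> hchi /andP[delta0 deps] eq_proj psi x Sx; rewrite /cutoff_proj.
have [xg|xNg] := boolP (gdist (kset g) x < eps).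
  exact: (eq_proj (fun x => (chi (gdist (kset g) x / delta))%:C *: psi x)).
have -> : chi (gdist (kset g) x / delta) = 0.
  apply: (cutoff_support hchi); rewrite (lt_le_trans _ (ler_norm _))//.
  by rewrite ltr_pdivlMr// mul1r (lt_le_trans deps)// leNgt.
have hdot0 s : hdot s ((0 : R)%:C *: psi x) = 0.
  by rewrite scale0r /hdot big1 // => k _; rewrite mxE mulr0.
by rewrite !hdot0 !scale0r.
Qed.

Theorem proposition8 (R : realType)
    (e : 'I_3 -> 'rV[R]_4 -> 'rV[R]_4) (he : is_frame e)
    (gamma : oriented_curve R) (hgamma : is_knot gamma)
    (S : oriented_surface R) (hS : is_seifert S gamma)
    (alpha : R) (halpha : 0 < alpha < 1)
    (chi : R -> R) (hchi : is_cutoff chi)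
    (eps delta : R) (heps : tubular_radius gamma eps) (hdelta : 0 < delta < eps)
    (F F' : seifert_frame R)
    (hF : is_seifert_frame e gamma S eps F)
    (hF' : is_seifert_frame e (opp_curve gamma) (opp_surface S) eps F') :
  let A := Potential S alpha in
  let A_opp := Potential (opp_surface S) alpha in
  let A_C := Potential (opp_surface S) (1 - alpha) in
  [/\ charge_conj @` op_dom (D_minus e chi delta F A)
        = op_dom (D_minus e chi delta F' A_opp),
      op_after charge_conj (D_minus e chi delta F A)
        = op_before (D_minus e chi delta F' A_opp) charge_conj
    & D_plus e chi delta F A = D_minus e chi delta F' A_C].
Proof.
move=> A A_opp A_C.
have bS : boundary (surf S) = kset gamma := seifert_boundary hS.
(* Since the tangent field of [F'] is opposite to that of [F], its +1 eigenspinor has eigenvalue -1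
   for [F]. *)
have eigen' x : tube gamma eps x ->
    clifford e x (dotv (fT F x)) *m xi_plus F' x = - xi_plus F' x.
  move=> xg; have [+ _] := xi_eigen hF' xg.
  rewrite (seifert_frame_opp _ _ _ _ _ _ _ hgamma hF hF' x xg) cliffordN mulNmx.
  by move=> /(congr1 -%R); rewrite opprK.
have norm' x : tube gamma eps x -> hdot (xi_plus F' x) (xi_plus F' x) = 1.
  by move=> xg; have [] := xi_normalized hF' xg.
have proj_conj psi x : sphere x ->
    charge_conj (cutoff_proj chi delta (kset gamma) (xi_plus F) psi) x =
    cutoff_proj chi delta (kset gamma) (xi_plus F') (charge_conj psi) x.
  move=> Sx; rewrite cutoff_proj_conj.
  apply: (eq_cutoff_proj _ _ _ _ _ _ hchi hdelta) => // phi y yg.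
  apply: (eigenspinor_projection (clifford e y (dotv (fT F y)))).
  - exact: clifford_trace.
  (* C anticommutes with the Clifford map, so it turns eigenvalue 1 into -1. *)
  - rewrite charge_conjE; have [eig _] := xi_eigen hF yg.
    by rewrite -[LHS]opprK -spinor_conj_clifford eig.
  - exact: eigen'.
  - rewrite charge_conjE hdot_conj; have [-> _] := xi_normalized hF yg.
    exact: conjc1.
  - exact: norm'.
have proj_minus psi x : sphere x ->
    cutoff_proj chi delta (kset gamma) (xi_minus F) psi x =
    cutoff_proj chi delta (kset gamma) (xi_plus F') psi x.
  apply: (eq_cutoff_proj _ _ _ _ _ _ hchi hdelta) => // phi y yg.
  apply: (eigenspinor_projection (clifford e y (dotv (fT F y)))).
  - exact: clifford_trace.
  - by have [] := xi_eigen hF yg.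
  - exact: eigen'.
  - by have [] := xi_normalized hF yg.
  - exact: norm'.
(* This equivalence of graphs, with surjectivity of C, yields both statements about conjugation. *)
have DC : forall w, D_minus e chi delta F A w <->
                    D_minus e chi delta F' A_opp (conj_pair w).
  by apply: D_ext_conj; rewrite /= bS; exact: proj_conj.
have surj (f : sfield R) : exists f', f = charge_conj f'.
  by exists (charge_conj (charge_conj (charge_conj f))); rewrite charge_conj4.
split.
- apply/seteqP; split=> [_ [psi [phi Dw] <-]|psi [phi]].
    by exists (charge_conj phi); exact: (DC (psi, phi)).1.
  have [[psi' ->] [phi' ->]] := (surj psi, surj phi).
  move=> /(DC (psi', phi')).2 Dw.
  by exists psi' => //; exists phi'.
- apply/seteqP; split=> -[psi phi].
    move=> [phi' Dw eq_phi].
    have {}eq_phi : phi = charge_conj phi' := eq_phi; rewrite eq_phi.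
    exact: (DC (psi, phi')).1.
  have [phi' ->] := surj phi.
  by move=> /(DC (psi, phi')).2 Dw; exists phi'.
- apply: D_ext_conj_potential; rewrite /= bS; exact: proj_minus.
Qed.
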